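(* Let $i\in P\cup W$ be a facility and let $b$ be its level. Let $l\in\{2,\ldots,|T|\}$, let $L^i=\{1,\ldots,l_i\}$ with $1\le l_i<l$, and let $S^i\subseteq L^i$. Let $b'\in\{1,2\}$ be a level with $b'>b$, and for each $j\in\delta^{b'}(i)$ let $L^j=\{l_i+1,\ldots,l\}$ and $S^j\subseteq L^j$. Then the two-level inequality $$\sum_{k\in L^i\setminus S^i}x^i_k+\sum_{k\in S^i}d^i_{kl}\,y^i_k+\sum_{j\in\delta^{b'}(i)}\Big(\sum_{k\in L^j\setminus S^j}x^j_k+\sum_{k\in S^j}d^j_{kl}\,y^j_k\Big)\ \ge\ d^i_{1l}$$ is valid for $X^{STD}$, i.e. it is satisfied by every $(x,s,y)\in X^{STD}$.
   Context: Problem data (uncapacitated three-level lot-sizing and replenishment problem with a distribution structure). $T=\{1,\ldots,|T|\}$ is a finite set of consecutive periods. $F=P\cup W\cup R$ is a finite set of facilities (disjoint union), with $P=\{p\}$ (plant, level 0), $W$ the warehouses (level 1), $R$ the retailers (level 2). Each retailer $r\in R$ has a unique warehouse $\delta_w(r)\in W$; for $w\in W$, $\delta(w)=\{r\in R:\delta_w(r)=w\}$; and $\delta(p)=W$. For a facility $i$, $\delta^{b'}(i)$ denotes the set of its successors at level $b'$: $\delta^1(p)=W$, $\delta^2(p)=R$, $\delta^2(w)=\delta(w)$ for $w\in W$. Each retailer $r$ has demands $d^r_t\ge 0$, $t\in T$. Put $d^p_t=\sum_{r\in R}d^r_t$, $d^w_t=\sum_{r\in\delta(w)}d^r_t$ for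 $w\in W$, and for $i\in F$, $d^i_{kt}=\sum_{l=k}^{t}d^i_l$ for $1\le k\le t\le |T|$. $X^{STD}$ is the set of all $(x,s,y)$, with $x=(x^i_t)$, $s=(s^i_t)$, $y=(y^i_t)$ indexed by $i\in F$, $t\in T$, and with the convention $s^i_0=0$, satisfying: - $s^i_{t-1}+x^i_t=\sum_{j\in\delta(i)}x^j_t+s^i_t$ for $i\in P\cup W$, $t\in T$; - $s^r_{t-1}+x^r_t=d^r_t+s^r_t$ for $r\in R$, $t\in T$; - $x^i_t\le d^i_{t|T|}\,y^i_t$ for $i\in F$, $t\in T$; - $x^i_t,s^i_t\ge 0$ and $y^i_t\in\{0,1\}$ for $i\in F$, $t\in T$. *)

(* Defs.v *)
From HB Require Import structures.
From mathcomp Require Import all_boot all_order all_algebra.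

Set Implicit Arguments.
Unset Strict Implicit.
Unset Printing Implicit Defensive.

Import Order.TTheory GRing.Theory Num.Theory.
Local Open Scope ring_scope.

Section Facility.
Variables W R : Type.

Inductive facility := Plant | Warehouse of W | Retailer of R.

Definition level (i : facility) : nat :=
  match i with Plant => 0 | Warehouse _ => 1 | Retailer _ => 2 end.

Definition facility_code (i : facility) : unit + (W + R) :=
  match i with
  | Plant => inl tt
  | Warehouse w => inr (inl w)
  | Retailer r => inr (inr r)
  end.

Definition facility_decode (c : unit + (W + R)) : facility :=
  match c with
  | inl _ => Plant
  | inr (inl w) => Warehouse w
  | inr (inr r) => Retailer r
  end.

Lemma facility_codeK : cancel facility_code facility_decode.
Proof. by case. Qed.

End Facility.

Arguments Plant {W R}.
Arguments Warehouse {W R} w.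
Arguments Retailer {W R} r.

HB.instance Definition _ (W R : eqType) :=
  Equality.copy (facility W R) (can_type (@facility_codeK W R)).
HB.instance Definition _ (W R : choiceType) :=
  Choice.copy (facility W R) (can_type (@facility_codeK W R)).
HB.instance Definition _ (W R : countType) :=
  Countable.copy (facility W R) (can_type (@facility_codeK W R)).
HB.instance Definition _ (W R : finType) :=
  Finite.copy (facility W R) (can_type (@facility_codeK W R)).

(* The set {a, ..., b}, both bounds included. *)
Definition periods (a b : nat) : seq nat := index_iota a b.+1.

Section LotSizing.
Variables (K : realFieldType) (n : nat) (W R : finType).
Variables (dw : R -> W) (d : R -> nat -> K).

Definition succ (i : facility W R) : {set facility W R} :=
  [set j | match i, j with
           | Plant, Warehouse _ => true
           | Warehouse w, Retailer r => dw r == w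
           | _, _ => false
           end].

Definition succ_at (b : nat) (i : facility W R) : {set facility W R} :=
  [set j | (level j == b) &&
           match i, j with
           | Plant, Warehouse _ => true
           | Plant, Retailer _ => true
           | Warehouse w, Retailer r => dw r == w
           | _, _ => false
           end].

Definition dem (i : facility W R) (t : nat) : K :=
  match i with
  | Plant => \sum_(r : R) d r t
  | Warehouse w => \sum_(r : R | dw r == w) d r t
  | Retailer r => d r t
  end.

Definition cumdem (i : facility W R) (k t : nat) : K :=
  \sum_(l <- periods k t) dem i l.

(* The horizon is T = {1, ..., n}. Variables are functions on all of nat, but
   only their values on T are constrained, apart from s i 0 = 0. *)
Record XSTD (x s y : facility W R -> nat -> K) : Prop := {
  XSTD_s0 : forall i, s i 0%N = 0;
  XSTD_flow : forall i t, (level i < 2)%N -> t \in periods 1 n ->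
    s i t.-1 + x i t = \sum_(j in succ i) x j t + s i t;
  XSTD_demand : forall r t, t \in periods 1 n ->
    s (Retailer r) t.-1 + x (Retailer r) t = d r t + s (Retailer r) t;
  XSTD_setup : forall i t, t \in periods 1 n ->
    x i t <= cumdem i t n * y i t;
  XSTD_x_ge0 : forall i t, t \in periods 1 n -> 0 <= x i t;
  XSTD_s_ge0 : forall i t, t \in periods 1 n -> 0 <= s i t;
  XSTD_y_bin : forall i t, t \in periods 1 n -> y i t = 0 \/ y i t = 1
}.

End LotSizing.

(* Main.v *)
(* The echelon stock of a facility (its own stock plus that of all its
   descendants) is nonnegative and obeys E_(t-1) + x_t = d_t + E_t. Scanning the
   periods, as long as the facility is not set up in a period of S, the terms of
   the inequality dominate the production; the first set-up at a period k of S
   covers all the demand of k, ..., l at once. If i is never set up in S^i, what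
   is left to cover is the demand of l_i+1, ..., l minus the echelon stock of i,
   which dominates the total echelon stock of its successors at level b', and
   the same argument applies to each of these successors. *)
Require Import Defs.
From mathcomp Require Import all_boot all_order all_algebra.
From mathcomp Require Import lra.
Import Order.TTheory GRing.Theory Num.Theory.
Local Open Scope ring_scope.

Lemma mem_periods a b k : (k \in periods a b) = (a <= k <= b)%N.
Proof. by rewrite mem_index_iota. Qed.

Lemma periods_recl a b : (a <= b)%N -> periods a b = a :: periods a.+1 b.
Proof. by move=> le_ab; rewrite /periods /index_iota subSS subSn. Qed.

Lemma periods_nil a b : (b < a)%N -> periods a b = [::].
Proof. by move=> lt_ba; rewrite /periods /index_iota (eqP lt_ba). Qed.

(** * Covering the demand at a single facility *)

Section SingleFacility.
Set Implicit Arguments.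
Unset Strict Implicit.
Variables (K : realFieldType) (D x y E : nat -> K) (S : pred nat) (l : nat).

(** The contribution of period [k] to the left-hand side. [D], [x], [y], [E] stay abstract so that
    one argument serves [i] and each of its successors. *)
Definition cover_term (k : nat) : K :=
  if k \in S then (\sum_(t <- periods k l) D t) * y k else x k.

Lemma sum_cover_term (s : seq nat) :
  \sum_(k <- s) cover_term k =
  \sum_(k <- s | k \notin S) x k
  + \sum_(k <- s | k \in S) (\sum_(t <- periods k l) D t) * y k.
Proof.
rewrite (bigID (mem S)) /= addrC; congr (_ + _).
  by apply: eq_bigr => k /negPf kS; rewrite /cover_term kS.
by apply: eq_bigr => k kS; rewrite /cover_term kS.
Qed.

Hypothesis D_ge0 : forall t, t \in periods 1 l -> 0 <= D t.
Hypothesis x_ge0 : forall t, t \in periods 1 l -> 0 <= x t.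
Hypothesis y_bin : forall t, t \in periods 1 l -> y t = 0 \/ y t = 1.
Hypothesis x_setup : forall t, t \in periods 1 l -> y t = 0 -> x t = 0.
Hypothesis E_ge0 : forall t, (t <= l)%N -> 0 <= E t.
Hypothesis flow :
  forall t, t \in periods 1 l -> E t.-1 + x t = D t + E t.

Lemma cover_term_ge0 k : k \in periods 1 l -> 0 <= cover_term k.
Proof.
move=> kl; rewrite /cover_term; case: ifP => _; last exact: x_ge0.
apply: mulr_ge0; last by case: (y_bin kl) => ->.
rewrite big_seq; apply: sumr_ge0 => t; rewrite mem_periods => /andP[kt tl].
move: kl; rewrite mem_periods => /andP[k1 _].
by apply: D_ge0; rewrite mem_periods tl (leq_trans k1 kt).
Qed.

Lemma sum_cover_term_ge0 a m : (0 < a)%N -> (m <= l)%N ->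
  0 <= \sum_(k <- periods a m) cover_term k.
Proof.
move=> a0 ml; rewrite big_seq; apply: sumr_ge0 => k.
rewrite mem_periods => /andP[ak km]; apply: cover_term_ge0.
by rewrite mem_periods (leq_trans a0 ak) (leq_trans km ml).
Qed.

(* V stands for the part of the inequality that covers the periods after m. *)
Lemma demand_covered (V : K) (a m : nat) :
  (0 < a)%N -> (a <= m.+1)%N -> (m <= l)%N -> 0 <= V ->
  \sum_(t <- periods m.+1 l) D t <= E m + V ->
  \sum_(t <- periods a l) D t
    <= E a.-1 + \sum_(k <- periods a m) cover_term k + V.
Proof.
move=> a0 am ml V0 HV.
(* Induction on the number of periods in [a], ..., [m]. In the base case [a = m.+1] the sum of terms
   is empty and the claim is [HV]. *)
have [p] := ubnP (m.+1 - a); elim: p a a0 am => // p IHp a a0 am ltp.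
move: am; rewrite leq_eqVlt => /predU1P[->|am].
  by rewrite [periods m.+1 m]periods_nil // big_nil addr0.
have al : a \in periods 1 l by rewrite mem_periods a0 (leq_trans _ ml).
have rest_ge0 := sum_cover_term_ge0 (a := a.+1) isT ml.
have Ea_ge0 : 0 <= E a.-1.
  by apply: E_ge0; apply: leq_trans (leq_pred a) (leq_trans _ ml).
have -> : \sum_(k <- periods a m) cover_term k
          = cover_term a + \sum_(k <- periods a.+1 m) cover_term k.
  by rewrite periods_recl // big_cons.
have dal : \sum_(t <- periods a l) D t
           = D a + \sum_(t <- periods a.+1 l) D t.
  by rewrite periods_recl ?big_cons // (leq_trans _ ml).
have IH : \sum_(t <- periods a.+1 l) D t
            <= E a + \sum_(k <- periods a.+1 m) cover_term k + V.
  by apply: IHp => //; move: ltp; rewrite ltnS subSS subSn.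
have fl := flow al; have xs := x_setup al.
(* Outside [S] the term is [x a], and the balance at [a] reduces the claim to [IH]. *)
rewrite {1}/cover_term; case: ifP => _; last by lra.
(* If [y a = 1], the term is the whole demand of [a], ..., [l] and the other summands are
   nonnegative. If [y a = 0], the term and [x a] both vanish, so the balance applies as before. *)
case: (y_bin al) => ya; rewrite ya ?mulr0 ?mulr1; last by lra.
by have := xs ya; lra.
Qed.

End SingleFacility.

(** * Demands and echelon stocks in the distribution tree *)

Section Echelon.
Set Implicit Arguments.
Unset Strict Implicit.
Variables (K : realFieldType) (n : nat) (W R : finType).
Variables (dw : R -> W) (d : R -> nat -> K).

Lemma sum_facility (F : facility W R -> K) :
  \sum_j F j
  = F Plant + \sum_(w : W) F (Warehouse w) + \sum_(r : R) F (Retailer r).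
Proof.
rewrite (reindex (@facility_decode W R)) /=; last first.
  exists (@facility_code W R) => j _; last exact: facility_codeK.
  by case: j => [[]|[]].
rewrite big_sumType /= big_sumType /= addrA; congr (_ + _ + _).
by rewrite (big_pred1 tt) //; case.
Qed.

Lemma sum_succ_at (b : nat) (i : facility W R) (F : facility W R -> K) :
  \sum_(j in succ_at dw b i) F j =
  match i, b with
  | Plant, 1 => \sum_(w : W) F (Warehouse w)
  | Plant, 2 => \sum_(r : R) F (Retailer r)
  | Warehouse w, 2 => \sum_(r : R | dw r == w) F (Retailer r)
  | _, _ => 0
  end.
Proof.
rewrite big_mkcond sum_facility inE.
under eq_bigr do rewrite inE.
under [X in _ + X]eq_bigr do rewrite inE.
case: i => [|w|r]; case: b => [|[|[|b]]] /=; rewrite ?big1_eq ?add0r ?addr0 //.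
by rewrite -big_mkcond.
Qed.

Lemma succE (i : facility W R) : succ dw i = succ_at dw (level i).+1 i.
Proof. by apply/setP => j; rewrite !inE; case: i j => [|w|r] [|w'|r']. Qed.

Lemma sum_by_warehouse (F : R -> K) :
  \sum_(w : W) \sum_(r : R | dw r == w) F r = \sum_(r : R) F r.
Proof. by rewrite [RHS](partition_big dw xpredT). Qed.

Lemma dem_succ_at (b : nat) (i : facility W R) (t : nat) :
  (level i < b <= 2)%N ->
  \sum_(j in succ_at dw b i) dem dw d j t = dem dw d i t.
Proof.
by rewrite sum_succ_at; case: i b => [|w|r] [|[|[|b]]] //= _;
  rewrite ?sum_by_warehouse.
Qed.

(** The retailers below [i] are partitioned among its successors at level [b], whose demands
    therefore add up to that of [i]. *)
Lemma cumdem_succ_at (b : nat) (i : facility W R) (k t : nat) :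
  (level i < b <= 2)%N ->
  \sum_(j in succ_at dw b i) cumdem dw d j k t = cumdem dw d i k t.
Proof.
move=> ib; rewrite /cumdem exchange_big /=.
by apply: eq_bigr => u _; exact: dem_succ_at.
Qed.

Lemma dem_ge0 (i : facility W R) (t : nat) :
  (forall r, 0 <= d r t) -> 0 <= dem dw d i t.
Proof. by move=> dt; case: i => [|w|r] //=; apply: sumr_ge0. Qed.

(** One formula for all levels: the level-1 sum is empty for a warehouse, and both sums are empty
    for a retailer. *)
Definition echelon (s : facility W R -> nat -> K) (i : facility W R) (t : nat) :=
  s i t + \sum_(j in succ_at dw 1 i) s j t + \sum_(j in succ_at dw 2 i) s j t.

Variables x s y : facility W R -> nat -> K.
Hypothesis xsy : XSTD n dw d x s y.

Lemma stock_ge0 (i : facility W R) (t : nat) : (t <= n)%N -> 0 <= s i t.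
Proof.
case: t => [|t] tn; first by rewrite (XSTD_s0 xsy).
by apply: (XSTD_s_ge0 xsy); rewrite mem_periods.
Qed.

Lemma echelon0 (i : facility W R) : echelon s i 0 = 0.
Proof.
by rewrite /echelon !big1 ?addr0 ?(XSTD_s0 xsy) // => j _; exact: XSTD_s0 xsy j.
Qed.

Lemma echelon_ge0 (i : facility W R) (t : nat) :
  (t <= n)%N -> 0 <= echelon s i t.
Proof.
by move=> tn; rewrite !addr_ge0 ?sumr_ge0 // => *; exact: stock_ge0.
Qed.

(** Add the balances of [i] and of all its descendants: shipments between them cancel, leaving the
    inflow [x i t] and the retailers' demand. *)
Lemma echelon_flow (i : facility W R) (t : nat) : t \in periods 1 n ->
  echelon s i t.-1 + x i t = dem dw d i t + echelon s i t.
Proof.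
move=> tT; rewrite /echelon !sum_succ_at.
have flowR (P : pred R) :
    \sum_(r | P r) s (Retailer r) t.-1 + \sum_(r | P r) x (Retailer r) t
    = \sum_(r | P r) d r t + \sum_(r | P r) s (Retailer r) t.
  by rewrite -!big_split; apply: eq_bigr => r _; exact: (XSTD_demand xsy).
have flowW w : s (Warehouse w) t.-1 + x (Warehouse w) t
    = \sum_(r | dw r == w) x (Retailer r) t + s (Warehouse w) t.
  by have := XSTD_flow xsy (i := Warehouse w) isT tT; rewrite succE sum_succ_at.
case: i => [|w|r] /=.
- have := XSTD_flow xsy (i := Plant) isT tT; rewrite succE sum_succ_at /=.
  have := flowR xpredT.
  have : \sum_w s (Warehouse w) t.-1 + \sum_w x (Warehouse w) t
      = \sum_r x (Retailer r) t + \sum_w s (Warehouse w) t.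
    rewrite -sum_by_warehouse -!big_split.
    by apply: eq_bigr => w _; exact: flowW.
  lra.
- by have := flowR (fun r => dw r == w); have := flowW w; lra.
- by rewrite !addr0; exact: (XSTD_demand xsy).
Qed.

(** The successors have disjoint sets of descendants. The slack is the stock of [i] and, from plant
    to retailers, that of the warehouses. *)
Lemma echelon_succ_at_le (b : nat) (i : facility W R) (t : nat) :
  (level i < b <= 2)%N -> (t <= n)%N ->
  \sum_(j in succ_at dw b i) echelon s j t <= echelon s i t.
Proof.
move=> ib tn; rewrite sum_succ_at /echelon !sum_succ_at.
have si := stock_ge0 i tn.
case: i b ib si => [|w|r] [|[|[|b]]] //= _ si;
  under eq_bigr do rewrite !sum_succ_at /= !addr0.
- by rewrite big_split /= sum_by_warehouse; lra.
- have : 0 <= \sum_w s (Warehouse w) t by apply: sumr_ge0 => *; exact: stock_ge0.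
  lra.
- by lra.
Qed.

Lemma no_setup_no_production (i : facility W R) (t : nat) :
  t \in periods 1 n -> y i t = 0 -> x i t = 0.
Proof.
move=> tT y0; apply/le_anti; rewrite (XSTD_x_ge0 xsy) // andbT.
by have := XSTD_setup xsy i tT; rewrite y0 mulr0.
Qed.

End Echelon.

Theorem proposition2 (K : realFieldType) (n : nat) (W R : finType)
  (dw : R -> W) (d : R -> nat -> K)
  (d_ge0 : forall (r : R) (t : nat), t \in periods 1 n -> 0 <= d r t)
  (i : facility W R) (i_PW : (level i < 2)%N)
  (l : nat) (l_range : l \in periods 2 n)
  (li : nat) (li_range : (1 <= li < l)%N)
  (Si : pred nat) (Si_sub : {subset Si <= periods 1 li})
  (b' : nat) (b'_range : b' = 1%N \/ b' = 2%N) (b'_gt : (level i < b')%N)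
  (Sj : facility W R -> pred nat)
  (Sj_sub : forall j, j \in succ_at dw b' i ->
             {subset Sj j <= periods li.+1 l}) :
  forall x s y : facility W R -> nat -> K,
  XSTD n dw d x s y ->
  \sum_(k <- periods 1 li | k \notin Si) x i k
  + \sum_(k <- periods 1 li | k \in Si) cumdem dw d i k l * y i k
  + \sum_(j in succ_at dw b' i)
      (\sum_(k <- periods li.+1 l | k \notin Sj j) x j k
       + \sum_(k <- periods li.+1 l | k \in Sj j) cumdem dw d j k l * y j k)
  >= cumdem dw d i 1 l.
Proof.
move=> x s y xsy; have := l_range; rewrite mem_periods => /andP[_ ln].
have sub t : t \in periods 1 l -> t \in periods 1 n.
  by rewrite !mem_periods => /andP[-> tl]; exact: leq_trans tl ln.
have /andP[_ li_l] := li_range.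
have ib : (level i < b' <= 2)%N by rewrite b'_gt; case: b'_range => ->.
have D_ge0 j t : t \in periods 1 l -> 0 <= dem dw d j t.
  by move=> /sub tT; apply: dem_ge0 => r; exact: d_ge0.
have x_ge0 j t : t \in periods 1 l -> 0 <= x j t.
  by move=> /sub; exact: (XSTD_x_ge0 xsy).
have y_bin j t : t \in periods 1 l -> y j t = 0 \/ y j t = 1.
  by move=> /sub; exact: (XSTD_y_bin xsy).
have setup j t : t \in periods 1 l -> y j t = 0 -> x j t = 0.
  by move=> /sub; exact: (no_setup_no_production xsy).
have E_ge0 j t : (t <= l)%N -> 0 <= echelon dw s j t.
  by move=> tl; apply: (echelon_ge0 xsy); exact: leq_trans tl ln.
have flow j t : t \in periods 1 l ->
    echelon dw s j t.-1 + x j t = dem dw d j t + echelon dw s j t.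
  by move=> /sub; exact: (echelon_flow xsy).
under [X in _ <= _ + X]eq_bigr => j _ do
  rewrite -(sum_cover_term (dem dw d j) (x j) (y j) (Sj j) l).
rewrite -(sum_cover_term (dem dw d i) (x i) (y i) Si l).
set V := (X in _ <= _ + X).
have V_ge0 : 0 <= V.
  by apply: sumr_ge0 => j _; apply: sum_cover_term_ge0; auto.
have V_covers : cumdem dw d i li.+1 l <= echelon dw s i li + V.
  (* Both the demand and the available echelon stock are distributed over the successors, so the
     bound can be proved for each [j] separately. *)
  rewrite -(cumdem_succ_at _ _ _ _ ib).
  have := echelon_succ_at_le xsy ib (ltnW (leq_trans li_l ln)).
  rewrite -(lerD2r V); apply: le_trans; rewrite -big_split /=.
  (* The added 0 plays the part of [V] for [j]: its scan runs over [li.+1], ..., [l], and no demand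
     is left after [l]. *)
  apply: ler_sum => j _; rewrite -[leRHS]addr0.
  apply: (demand_covered (E := echelon dw s j)) => //; auto.
  by rewrite [periods l.+1 l]periods_nil // big_nil addr0; exact: E_ge0.
(* The scan of [i] over [1], ..., [li] starts from the echelon stock of period 0, which is zero. *)
have := demand_covered Si (D_ge0 i) (x_ge0 i) (y_bin i) (setup i) (E_ge0 i)
  (flow i) (a := 1) isT isT (ltnW li_l) V_ge0 V_covers.
by rewrite /= (echelon0 xsy) add0r.
Qed.
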